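(* Let $k\ge1$, $r\ge2$ and $n\ge rk$ be integers, and let $t$ be an integer with $t\le r(k-2)+1$. Then $$\chi(\mathrm{KG}^r(n,k)_{t\text{-wide}})=\left\lceil\frac{n-r(k-1)}{r-1}\right\rceil.$$
   Context: $\mathrm{KG}^r(n,k)$ is the $r$-uniform Kneser hypergraph whose vertices are all $k$-subsets of $[n]$ and whose edges are all $r$-subsets $\{F_1,\dots,F_r\}$ of pairwise disjoint vertices. $\mathrm{KG}^r(n,k)_{t\text{-wide}}$ is its sub-hypergraph induced by the $k$-subsets that are not contained in any of the sets $\{i,i+1,\dots,i+t-1\}$ for $i\in[n-t+1]$. $\chi$ is the chromatic number (minimum number of colors in a vertex coloring with no monochromatic edge). *)

(* Defs.v *)
From mathcomp Require Import all_boot all_order all_algebra.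

Set Implicit Arguments.
Unset Strict Implicit.
Unset Printing Implicit Defensive.

(** A hypergraph whose vertices are all the elements of a finite type [V] is
    given by its set of edges. *)
Definition hypergraph (V : finType) := {set {set V}}.

Definition monochromatic (V : finType) (c : nat) (f : {ffun V -> 'I_c})
    (e : {set V}) : bool :=
  [exists a, [forall v in e, f v == a]].

Definition proper_coloring (V : finType) (H : hypergraph V) (c : nat)
    (f : {ffun V -> 'I_c}) : bool :=
  [forall e in H, ~~ monochromatic f e].

Definition colorable (V : finType) (H : hypergraph V) (c : nat) : bool :=
  [exists f : {ffun V -> 'I_c}, proper_coloring H f].

(** The search is restricted to [c <= #|V|] because giving distinct colors to
    distinct vertices is a proper coloring as soon as every edge has at least
    two vertices; [chromatic_numberP] shows that the minimum is then attained
    and is the minimum over all [c].  When some edge has fewer than two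
    vertices, the value can be meaningless. *)
Definition chromatic_number (V : finType) (H : hypergraph V) : nat :=
  [arg min_(c < (ord_max : 'I_#|V|.+1) | colorable H c) (c : nat)].

Lemma colorable_card (V : finType) (H : hypergraph V) :
  (forall e, e \in H -> 1 < #|e|) -> colorable H #|V|.
Proof.
move=> H2; apply/existsP; exists [ffun v => enum_rank v].
apply/forall_inP => e /H2 /card_gt1P [x [y [xe ye xy]]].
apply/negP => /existsP [a /forall_inP ea].
move: (ea _ xe) (ea _ ye); rewrite !ffunE => /eqP <- /eqP /enum_rank_inj yx.
by rewrite yx eqxx in xy.
Qed.

Lemma chromatic_numberP (V : finType) (H : hypergraph V) :
  (forall e, e \in H -> 1 < #|e|) ->
  colorable H (chromatic_number H) /\
  (forall c, colorable H c -> chromatic_number H <= c).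
Proof.
move=> H2; rewrite /chromatic_number.
case: arg_minnP => [|i Hi min_i]; first exact: colorable_card.
split=> // c Hc; case: (leqP c #|V|) => [cV|/ltnW cV].
  by have := min_i (Ordinal (cV : c < #|V|.+1)) Hc.
by apply: leq_trans cV; rewrite -ltnS.
Qed.

Definition induced (V : finType) (H : hypergraph V) (W : {set V}) :
    hypergraph {v : V | v \in W} :=
  [set e : {set {v : V | v \in W}} | (val @: e) \in H].

(** [n] is represented by ['I_n], that is by 0, ..., n-1 instead of
    1, ..., n. *)
Definition ksubset (n k : nat) := {A : {set 'I_n} | #|A| == k}.

Definition kneser (r n k : nat) : hypergraph (ksubset n k) :=
  [set e : {set ksubset n k} |
    (#|e| == r) &&
    [forall A in e, forall B in e, (A != B) ==> [disjoint val A & val B]]].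

(** The set {i, i+1, ..., i+t-1}, which is empty if [t <= 0]. *)
Definition window (n : nat) (t : int) (i : nat) : {set 'I_n} :=
  [set a : 'I_n | (Posz i <= Posz a)%R && (Posz a < Posz i + t)%R].

(** The windows start at i = 0, ..., n-t, because of the shift by one;
    [Num.truncn] sends negative integers to 0. *)
Definition wide (n k : nat) (t : int) : {set ksubset n k} :=
  [set A : ksubset n k |
    [forall i : 'I_(Num.truncn (Posz n - t + 1)%R),
      ~~ (val A \subset window n t i)]].

Definition kneser_wide (r n k : nat) (t : int) :
    hypergraph {A : ksubset n k | A \in wide n k t} :=
  induced (kneser r n k) (wide n k t).

Lemma card_kneser_wide (r n k : nat) (t : int) e :
  e \in kneser_wide r n k t -> #|e| = r.
Proof.
by rewrite !inE => /andP [/eqP <- _]; rewrite card_imset //; exact: val_inj.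
Qed.

(* Main.v *)
Require Import Defs.
From mathcomp Require Import all_boot all_order all_algebra.
From mathcomp Require Import zify ring.

(** Lower bound: cut [n] into consecutive blocks of size at most r.  A k-set
    with at most one element in each block ("rainbow") meets k blocks, so it
    spans at least r(k-2)+2 integers and is t-wide.  It thus suffices to find,
    when n > (r-1)c + r(k-1), r disjoint rainbow k-sets of the same color among
    c colors.  If this holds for r1 and r2, it holds for r1 * r2: split each
    block in r1 subblocks of size r2, color each set S of size (r1-1)c + r1(k-1)
    + 1 which is rainbow for the subblocks (so has at most r1 elements in each
    block) by the color of r1 disjoint rainbow k-sets in S, and apply r2.

    For a prime p, suppose that there is no such family and consider nonzero
    sign vectors X : [n] -> Z/p + {0}, with classes X_i.  If no X_i contains a
    rainbow k-set, the level of X is the sum over the blocks of the number of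
    signs occurring there, at most p(k-1); otherwise it is p(k-1) plus the sum
    over the colors of the number of i such that X_i contains a rainbow k-set
    of this color, at most p(k-1) + (p-1)c.  Each number stems from a set of
    signs, which grows with X; from a proper nonempty one, the average of its
    elements gives an equivariant sign.  Only if all signs or none occur on each
    block is there no such set; but then X is a bijection on the blocks it meets.

    Such levels and signs are an equivariant simplicial map from the
    subdivision of (Z/p)^{*n} to (Z/p)^{*M}, M = p(k-1) + (p-1)c, so n <= M.
    This is proved by pairing chains h_j with boundary (alternately) N h_{j-1}
    and (1-g) h_{j-1} with explicit cochains satisfying the dual relation.

    Upper bound: give color j < c-1 to a set meeting the j-th interval of length
    r-1, and the color c-1 to the sets avoiding all these intervals. *)

Set Implicit Arguments.
Unset Strict Implicit.
Unset Printing Implicit Defensive.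

Import Order.TTheory GRing.Theory Num.Theory.
Local Open Scope ring_scope.

(** * A prism homotopy *)

Section Coboundary.
Variables (R : comNzRingType) (T : eqType).
Implicit Types (u w : seq T -> R) (s : seq T).

(** The augmented simplicial coboundary. Cochains are functions on sequences of all sizes, the empty
    one included, so no degree appears in the types. *)
Fixpoint cobd u s : R :=
  if s is x :: s' then u s' - cobd (fun t => u (x :: t)) s' else 0.

Lemma cobdB u w s : cobd (fun t => u t - w t) s = cobd u s - cobd w s.
Proof.
elim: s u w => [|x s IH] u w /=; first by rewrite subrr.
by rewrite (IH (fun t => u (x :: t)) (fun t => w (x :: t))); ring.
Qed.

Lemma cobd_sum m (F : 'I_m -> seq T -> R) s :
  cobd (fun t => \sum_i F i t) s = \sum_i cobd (F i) s.
Proof.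
elim: s F => [|x s IH] F /=; first by rewrite big1.
by rewrite (IH (fun i t => F i (x :: t))) sumrB.
Qed.

Lemma cobdZ a u s : cobd (fun t => a * u t) s = a * cobd u s.
Proof.
elim: s u => [|x s IH] u /=; first by rewrite mulr0.
by rewrite (IH (fun t => u (x :: t))) mulrBr.
Qed.

End Coboundary.

Lemma cobd_map (R : comNzRingType) (T T' : eqType) (f : T -> T')
    (u : seq T' -> R) s :
  cobd u (map f s) = cobd (fun t => u (map f t)) s.
Proof. by elim: s u => //= y s IH u; rewrite (IH (fun t => u (f y :: t))). Qed.

Section Homotopy.
Variables (R : comNzRingType) (T : eqType).
Implicit Types (u w : seq T -> R) (s : seq T).

(** Dual of the alternating sum of the simplices x_0 ... x_i f(x_i) ... f(x_m). *)
Fixpoint prism (f : T -> T) u s : R :=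
  if s is x :: s' then
    u (x :: f x :: map f s') - prism f (fun t => u (x :: t)) s'
  else 0.

(** Dual of the cone with apex [e] over the image under [f], minus the prism leading to that image:
    a contracting homotopy. *)
Definition fill (e : T) f u s : R := u (e :: map f s) - prism f u s.

(** The operators N and 1 - g of the periodic resolution of a cyclic group. *)
Definition tau (g : T -> T) m (b : bool) u s : R :=
  if b then \sum_(i < m) u (map (iter i g) s) else u s - u (map g s).

Lemma prismB f u w s :
  prism f (fun t => u t - w t) s = prism f u s - prism f w s.
Proof.
elim: s u w => [|x s IH] u w /=; first by rewrite subrr.
by rewrite (IH (fun t => u (x :: t)) (fun t => w (x :: t))); ring.
Qed.

Lemma prism_homotopy f u s :
  cobd (prism f u) s + prism f (cobd u) s = u (map f s) - u s.
Proof.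
elim: s u => [|x s IH] u /=; first by rewrite addr0 subrr.
rewrite (cobdB (fun t => u [:: x, f x & map f t])).
rewrite prismB.
rewrite -(cobd_map f (fun t => u [:: x, f x & t])).
move: (IH (fun t => u (x :: t))) => /= /(canRL (addrK _)) E; rewrite E; ring.
Qed.

Lemma fill_homotopy e f u s :
  cobd (fill e f u) s + fill e f (cobd u) s = u s.
Proof.
rewrite /fill (cobdB (fun t => u (e :: map f t))) /= cobd_map.
have /(canRL (addrK _)) E := prism_homotopy f u s; rewrite E; ring.
Qed.

Lemma cobd_tau g m b u s : cobd (tau g m b u) s = tau g m b (cobd u) s.
Proof.
case: b => /=.
  rewrite (cobd_sum (fun i t => u (map (iter i g) t))).
  by apply: eq_bigr => i _; rewrite cobd_map.
by rewrite (cobdB u) cobd_map.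
Qed.

Lemma tauB g m b u w s :
  tau g m b (fun t => u t - w t) s = tau g m b u s - tau g m b w s.
Proof. by case: b => /=; rewrite ?sumrB //; ring. Qed.

Lemma eq_tau g m b u w s : u =1 w -> tau g m b u s = tau g m b w s.
Proof. by case: b => /= E; rewrite ?E //; apply: eq_bigr => i _; rewrite E. Qed.

Lemma tau_tau g m b u s : iter m g =1 id ->
  tau g m b (tau g m (~~ b) u) s = 0.
Proof.
move=> gm; have telescope : \sum_(i < m) (u (map (iter i g) s) -
     u (map (iter i.+1 g) s)) = 0.
  rewrite -(big_mkord xpredT
    (fun i => u (map (iter i g) s) - u (map (iter i.+1 g) s))).
  rewrite -(opprK (\sum_(0 <= i < m) _)) -sumrN.
  under eq_bigr do rewrite opprB.
  rewrite telescope_sumr //= (eq_map gm) (eq_map (g := id)) //.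
  by rewrite subrr oppr0.
case: b => /=.
  rewrite -[RHS]telescope; apply: eq_bigr => i _.
  by rewrite -map_comp.
rewrite -[RHS]telescope sumrB; congr (_ - _); apply: eq_bigr => i _.
by rewrite -map_comp; congr u; apply: eq_map => x /=; rewrite -iterSr.
Qed.

Lemma eq_prism f u w s :
  (forall s1 x s2, s = s1 ++ x :: s2 ->
     u (s1 ++ x :: f x :: map f s2) = w (s1 ++ x :: f x :: map f s2)) ->
  prism f u s = prism f w s.
Proof.
elim: s u w => //= x s IH u w E.
rewrite (E [::]) // (IH _ (fun t => w (x :: t))) // => s1 y s2 es.
by rewrite (E (x :: s1) y s2) ?es.
Qed.

End Homotopy.

(** * Cocycles of a cyclic group *)

Section SignCochain.
Variable q : nat.
Local Notation G := 'I_q.+2.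
Implicit Types (a b c : G) (s : seq G).

Definition below a b : G := (a < b)%N%:R.

Definition orientation a b c : G := below b c - below a c + below a b.

(** Iterated cup products with the invariant cocycle [orientation], starting from
    an indicator function in degree 0 and from [below] in degree 1. *)
Fixpoint sign_cochain s : G :=
  match s with
  | [:: a] => (a + 1 == 0)%:R
  | [:: a; b] => below a b
  | a :: b :: (c :: _) as s' => orientation a b c * sign_cochain s'
  | [::] => 0
  end.

(** Adding 1 preserves the order except at -1, which wraps around to 0. Thus (1 - g) [below] is the
    coboundary of the indicator of -1. *)
Lemma below_shift a b :
  below a b - below (a + 1) (b + 1) = (b + 1 == 0)%:R - (a + 1 == 0)%:R.
Proof.
have valS c : (c + 1 : G) = (if c.+1 == q.+2 then 0 else c.+1) :> nat.
  rewrite /= (modn_small (isT : 1 < q.+2)%N) addn1.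
  case: eqP => [->|/eqP cq]; first by rewrite modnn.
  by rewrite modn_small // ltn_neqAle cq ltn_ord.
have eq0 c : (c + 1 == 0) = (c.+1 == q.+2).
  by rewrite -(inj_eq val_inj) /=; move: (valS c) => /= ->; case: ifP.
rewrite /below !eq0 !valS.
have := ltn_ord a; have := ltn_ord b.
case: (eqVneq a.+1) => ha; case: (eqVneq b.+1) => hb hb' ha' /=;
  rewrite ?subrr ?subr0 ?sub0r.
- by rewrite (_ : (a < b)%N = false) ?sub0r //; lia.
- by rewrite (_ : (a < b)%N = false) ?sub0r //; lia.
- by have -> : (a < b)%N by lia.
- by [].
Qed.

Lemma orientation_shift a b c :
  orientation (a + 1) (b + 1) (c + 1) = orientation a b c.
Proof.
have E1 := below_shift a b; have E2 := below_shift b c.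
have E3 := below_shift a c.
rewrite /orientation -[below a b](subrK (below (a + 1) (b + 1))) E1.
rewrite -[below b c](subrK (below (b + 1) (c + 1))) E2.
by rewrite -[below a c](subrK (below (a + 1) (c + 1))) E3; ring.
Qed.

Lemma orientation_iter i a b c :
  orientation (iter i (+%R^~ 1) a) (iter i (+%R^~ 1) b) (iter i (+%R^~ 1) c) =
  orientation a b c.
Proof. by elim: i => //= i IH; rewrite orientation_shift. Qed.

Lemma iter_shift i a : iter i (+%R^~ 1) a = a + i%:R.
Proof. by elim: i => [|i IH] /=; rewrite ?addr0 // IH -addrA natr1. Qed.

Lemma orientation_cocycle a b c d :
  orientation b c d - orientation a c d + orientation a b d = orientation a b c.
Proof. by rewrite /orientation; ring. Qed.

Lemma sum_shift_eq0 a : \sum_(i < q.+2) (a + i%:R + 1 == 0 :> G)%:R = 1 :> G.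
Proof.
have natr_ord (i : G) : i%:R = i := natr_Zp i.
rewrite (bigD1 (- a - 1)) // natr_ord (_ : a + (- a - 1) + 1 = 0); last by ring.
rewrite eqxx big1 => [|i ni]; first exact: addr0.
rewrite natr_ord.
rewrite (_ : _ == 0 = false) //; apply: contraNF ni => /eqP E.
by apply/eqP; rewrite -[RHS]addr0 -E; ring.
Qed.

(** Peel off two entries: the invariant cocycle [orientation] factors out of both sides. At the
    bottom, [below_shift] serves for size 2; for size 3, the coboundary of [below] is [orientation],
    and the shifts of the indicator sum to 1. *)
Lemma cobd_sign_cochain s : (1 < size s)%N ->
  cobd sign_cochain s = tau (+%R^~ 1) q.+2 (odd (size s)) sign_cochain s.
Proof.
have [n] := ubnP (size s); elim: n s => // n IH [|a [|b [|c s]]] //= sn _.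
  by rewrite /tau /= below_shift; ring.
case: s sn => [|d s] sn.
  rewrite /tau /=.
  under eq_bigr do rewrite orientation_iter iter_shift.
  by rewrite -mulr_sumr sum_shift_eq0 /orientation; ring.
have {IH} E : cobd sign_cochain [:: c, d & s] = _ := IH [:: c, d & s] _ isT.
transitivity (orientation a b c * cobd sign_cochain [:: c, d & s]).
  have := orientation_cocycle a b c d.
  case: s sn E => [|x s] _ _ /=; rewrite ?cobdZ => <-; ring.
rewrite E; last by move: sn; rewrite /= !ltnS => /ltnW.
rewrite /= negbK /tau; case: (odd _); last first.
  by rewrite /= orientation_shift mulrBr.
by rewrite mulr_sumr; apply: eq_bigr => i _ /=; rewrite orientation_iter.
Qed.

Lemma orientation_eq0 a b c : (a == b) || (b == c) -> orientation a b c = 0.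
Proof.
rewrite /orientation => /orP[] /eqP ->; rewrite ?subrr ?subKr ?add0r /below ltnn //.
by rewrite sub0r addNr.
Qed.

Lemma sign_cochain_sorted s :
  sign_cochain s != 0 -> sorted (fun a b => a != b) s.
Proof.
have [n] := ubnP (size s); elim: n s => // n IH [|a [|b [|c s]]] sn //.
  by rewrite /= andbT; apply: contra_neq => ->; rewrite /below ltnn.
move=> nz; have /norP[ab bc] : ~~ ((a == b) || (b == c)).
  by apply: contra nz => /orientation_eq0 /= ->; rewrite mul0r.
have /= -> := IH (c :: s); rewrite ?ab ?bc //.
  by move: sn; rewrite /= !ltnS => /ltnW.
by apply: contra_neq nz => /= ->; rewrite mulr0.
Qed.
End SignCochain.

(** * A monotone Z_p-Tucker lemma *)

Section Tucker.
Variables (q : nat) (V : finType).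
Local Notation G := 'I_q.+2.
Local Notation svec := {ffun V -> option G}.
Implicit Types (X Y : svec) (s : seq svec) (vs : seq V) (u w : seq svec -> G).

Definition empty : svec := [ffun=> None].
Definition shift X : svec := [ffun v => omap (+%R^~ 1) (X v)].
Definition put v X : svec := [ffun x => if x == v then Some 0 else X x].
Definition subsig X Y := [forall v, (X v == None) || (Y v == X v)].
Definition signed_on (A : {pred V}) X :=
  (X != empty) && [forall v, (X v != None) ==> (v \in A)].

(** Inclusions in a chain may be equalities. *)
Definition signed_chain vs s :=
  [&& size s == size vs, path subsig empty s & all (signed_on (mem vs)) s].

Definition twist j u :=
  if j is 0 then u else tau shift q.+2 (odd j) u.

(** The chain h_j, as a linear form on cochains.  The cone over the cycle z goes
    through the prism between z and its image by [put v]; no power of g is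
    applied in the lowest degree, where the chains are augmented. *)
Fixpoint eval_chain vs u : G :=
  if vs is v :: vs' then
    eval_chain vs' (twist (size vs') (fill (put v empty) (put v) u))
  else u [::].

Lemma subsigP X Y : reflect (forall v a, X v = Some a -> Y v = Some a) (subsig X Y).
Proof.
apply: (iffP forallP) => [XY v a Xv|XY v].
  by have := XY v; rewrite Xv => /eqP.
by case Xv: (X v) => [a|] //=; rewrite (XY _ _ Xv).
Qed.

Lemma subsig0 X : subsig empty X.
Proof. by apply/subsigP => v a; rewrite ffunE. Qed.

Lemma iter_shiftE i X v : iter i shift X v = omap (fun a => a + i%:R) (X v).
Proof.
elim: i => [|i IH] /=; first by case: (X v) => //= a; rewrite addr0.
by rewrite ffunE IH; case: (X v) => //= a; rewrite -addrA natr1.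
Qed.

Lemma natr_order : q.+2%:R = 0 :> G.
Proof. by rewrite Zp_nat; apply/val_inj; apply: modnn. Qed.

Lemma iter_shift_id : iter q.+2 shift =1 id.
Proof.
move=> X; apply/ffunP => v; rewrite iter_shiftE; case: (X v) => //= a.
by rewrite natr_order addr0.
Qed.

Lemma shift_eqN X v : (shift X v == None) = (X v == None).
Proof. by rewrite ffunE; case: (X v). Qed.

Lemma emptyPn X : reflect (exists v, X v != None) (X != empty).
Proof.
apply: (iffP idP) => [nX|[v]]; last by apply: contra_neq => ->; rewrite ffunE.
apply/existsP; apply: contraNT nX; rewrite negb_exists => /forallP X0.
by apply/eqP/ffunP => v; rewrite ffunE; apply/eqP; have := X0 v; rewrite negbK.
Qed.

Lemma signed_onP A X :
  reflect ((exists v, X v != None) /\ (forall v, X v != None -> v \in A))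
    (signed_on A X).
Proof.
apply: (iffP andP) => [[/emptyPn ? /forallP XA]|[? XA]].
  by split=> // v; apply/implyP.
by split; [apply/emptyPn | apply/forallP => v; apply/implyP/XA].
Qed.

Lemma shift_signed_on A X : signed_on A X -> signed_on A (shift X).
Proof.
case/signed_onP=> [[v Xv] XA]; apply/signed_onP; split.
  by exists v; rewrite shift_eqN.
by move=> w; rewrite shift_eqN; apply: XA.
Qed.

Lemma signed_on_sub (A B : {pred V}) X :
  {subset A <= B} -> signed_on A X -> signed_on B X.
Proof.
by move=> AB /signed_onP[? XA]; apply/signed_onP; split=> // v /XA /AB.
Qed.

Lemma put_signed_on v vs X :
  (forall x, X x != None -> x \in vs) -> signed_on (mem (v :: vs)) (put v X).
Proof.
move=> XA; apply/signed_onP; split; first by exists v; rewrite ffunE eqxx.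
move=> w; rewrite ffunE in_cons; by case: (eqVneq w v) => //= _; apply: XA.
Qed.

Lemma shift_signed_chain vs s : signed_chain vs s -> signed_chain vs (map shift s).
Proof.
case/and3P=> sz srt ok; apply/and3P; split; first by rewrite size_map.
  rewrite (_ : empty = shift empty); last by apply/ffunP => v; rewrite !ffunE.
  apply: homo_path srt => X Y /subsigP XY; apply/subsigP => v a.
  by rewrite !ffunE; case Xv: (X v) => [b|] //; rewrite (XY _ _ Xv).
by rewrite all_map; apply: sub_all ok => X; apply: shift_signed_on.
Qed.

Lemma put_subsig v X Y : subsig X Y -> subsig (put v X) (put v Y).
Proof.
move=> /subsigP XY; apply/subsigP => w a; rewrite !ffunE; case: eqP => // _.
exact: XY.
Qed.

Lemma subsig_put v vs X : v \notin vs -> signed_on (mem vs) X -> subsig X (put v X).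
Proof.
move=> vvs /signed_onP[_ XA]; apply/subsigP => w a Xw; rewrite ffunE.
by case: eqP => // wv; case/negP: vvs; rewrite -wv; apply: XA; rewrite Xw.
Qed.

Lemma all_put_signed v vs s : all (signed_on (mem vs)) s ->
  all (signed_on (mem (v :: vs))) (map (put v) s).
Proof.
rewrite all_map; apply: sub_all => X /signed_onP[_ XA].
by apply: put_signed_on => //.
Qed.

Lemma cone_signed_chain v vs s :
  signed_chain vs s -> signed_chain (v :: vs) (put v empty :: map (put v) s).
Proof.
case/and3P=> sz srt ok; apply/and3P; split; first by rewrite /= size_map eqSS.
  by rewrite /= subsig0; apply: homo_path srt => X Y; apply: put_subsig.
rewrite /= all_put_signed // andbT; apply: put_signed_on => // w.
by rewrite ffunE.
Qed.

Lemma prism_signed_chain v vs s1 X s2 : v \notin vs ->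
  signed_chain vs (s1 ++ X :: s2) ->
  signed_chain (v :: vs) (s1 ++ X :: put v X :: map (put v) s2).
Proof.
move=> vvs /and3P[sz]; rewrite cat_path all_cat /=.
case/and3P=> p1 X1 p2 /and3P[ok1 okX ok2].
have lift Y :=
  @signed_on_sub (mem vs) (mem (v :: vs)) Y (@mem_behead _ (v :: vs)).
apply/and3P; split.
- by move: sz; rewrite !size_cat /= size_map !addnS eqSS.
- rewrite cat_path p1 /= X1 (subsig_put vvs) //.
  by apply: homo_path p2 => Y Z; apply: put_subsig.
rewrite all_cat /= lift // (sub_all lift ok1) all_put_signed // andbT /=.
by apply: put_signed_on => // w; case/signed_onP: okX => _; apply.
Qed.

(** The chain h_j is supported on signed chains, as cones, prisms and shifts of these are again
    such. *)
Lemma eq_eval_chain vs u w : uniq vs ->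
  (forall s, signed_chain vs s -> u s = w s) -> eval_chain vs u = eval_chain vs w.
Proof.
elim: vs u w => [|v vs IH] u w /=; first by move=> _; apply.
case/andP=> vvs uvs E; apply: IH => // s s_vs.
have fillE t : signed_chain vs t ->
    fill (put v empty) (put v) u t = fill (put v empty) (put v) w t.
  move=> t_vs; congr (_ - _); first exact/E/cone_signed_chain.
  apply: eq_prism => s1 X s2 et; apply: E.
  by apply: prism_signed_chain => //; rewrite -et.
case: {E uvs vvs} (size vs) => [|j] /=; first exact: fillE.
have shiftE i : signed_chain vs (map (iter i shift) s).
  elim: i => [|i IHi]; first by rewrite map_id.
  rewrite (eq_map (_ : iter i.+1 shift =1 shift \o iter i shift)) // map_comp.
  exact: shift_signed_chain.
rewrite /tau; case: ifP => _; first by apply: eq_bigr => i _; apply: fillE.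
by rewrite (fillE s) // (fillE (map shift s)) //; apply: shift_signed_chain.
Qed.

Lemma eq_eval vs u w : u =1 w -> eval_chain vs u = eval_chain vs w.
Proof.
elim: vs u w => [|v vs IH] u w E /=; first exact: E.
apply: IH => s.
have fillE t : fill (put v empty) (put v) u t = fill (put v empty) (put v) w t.
  by rewrite /fill E; congr (_ - _); apply: eq_prism => *.
by case: (size vs) => [|j] /=; [apply: fillE | apply: eq_tau].
Qed.

Lemma twistB j u w s :
  twist j (fun t => u t - w t) s = twist j u s - twist j w s.
Proof. by case: j => //= j; rewrite tauB. Qed.

Lemma eq_twist j u w s : u =1 w -> twist j u s = twist j w s.
Proof. by case: j => [|j] E; [apply: E | apply: eq_tau]. Qed.

Lemma fillB e f u w s :
  fill e f (fun t => u t - w t) s = fill e f u s - fill e f w s :> G.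
Proof.
rewrite /fill prismB; ring.
Qed.

Lemma eval_chainB vs u w :
  eval_chain vs (fun t => u t - w t) = eval_chain vs u - eval_chain vs w.
Proof.
elim: vs u w => //= v vs IH u w; rewrite -IH; apply: eq_eval => s.
by rewrite -twistB; apply: eq_twist => t; apply: fillB.
Qed.

Lemma cobd_twist j u s : cobd (twist j u) s = twist j (cobd u) s.
Proof. by case: j => //= j; apply: cobd_tau. Qed.

(** Dual to the boundary relation for h_j. The boundary of the filling of z is z minus the filling
    of the boundary of z; here z is a twist of h_{j-1}, whose boundary vanishes because N(1 - g) =
    0. *)
Lemma eval_chain_cobd v vs u :
  eval_chain (v :: vs) (cobd u) = eval_chain vs (twist (size vs) u).
Proof.
elim: vs v u => [|v' vs IH] v u.
  have /(canRL (addKr _)) := fill_homotopy (put v empty) (put v) u [::].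
  by rewrite /= oppr0 add0r.
pose f (u0 : seq svec -> G) : seq svec -> G := fill (put v empty) (put v) u0.
have E : twist (size (v' :: vs)) (f (cobd u)) =1 fun s =>
    twist (size (v' :: vs)) u s - cobd (twist (size (v' :: vs)) (f u)) s.
  move=> s; rewrite cobd_twist -twistB; apply: eq_twist => t.
  by rewrite -(fill_homotopy (put v empty) (put v) u t) addrC addKr.
rewrite -[LHS]/(eval_chain (v' :: vs) (twist (size (v' :: vs)) (f (cobd u)))).
rewrite (eq_eval _ E) eval_chainB IH -[RHS]subr0; congr (_ - _).
set z := f u; transitivity (eval_chain vs (fun=> 0 - 0)).
  (* In the lowest degree the boundary is an augmentation: q.+2 copies of one value, which is zero
     in [G]. *)
  case: vs {IH E} => [|v2 vs].
    by rewrite /= /tau /= subrr sumr_const card_ord -mulr_natl natr_order mul0r.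
  by apply: eq_eval => s; rewrite subr0; apply/tau_tau/iter_shift_id.
by rewrite (eval_chainB vs (fun=> 0) (fun=> 0)) subrr.
Qed.

(** * Pulling the sign cochains back along an equivariant sign *)

Section Equivariant.
Variables (A : {pred V}) (sg : svec -> G) (lv : svec -> nat) (M : nat).
Hypothesis sg_shift : forall X, signed_on A X -> sg (shift X) = sg X + 1.
Hypothesis lv_bound : forall X, signed_on A X -> (0 < lv X <= M)%N.
Hypothesis lv_le : forall X Y,
  signed_on A X -> signed_on A Y -> subsig X Y -> (lv X <= lv Y)%N.
Hypothesis sg_lv : forall X Y, signed_on A X -> signed_on A Y -> subsig X Y ->
  lv X = lv Y -> sg X = sg Y.

Let sgc s := sign_cochain (map sg s).

Lemma signed_chain_on vs s : {subset vs <= A} -> signed_chain vs s ->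
  all (signed_on A) s.
Proof.
move=> vsA /and3P[_ _]; apply: sub_all => X; exact: signed_on_sub.
Qed.

Lemma iter_shift_signed_on i X : signed_on A X -> signed_on A (iter i shift X).
Proof. by move=> AX; elim: i => //= i; apply: shift_signed_on. Qed.

Lemma sgc_iter_shift s i : all (signed_on A) s ->
  sgc (map (iter i shift) s) = sign_cochain (map (iter i (+%R^~ 1)) (map sg s)).
Proof.
move=> /allP As; rewrite /sgc -!map_comp; congr sign_cochain.
apply/eq_in_map => X /As AX /=; elim: i => //= i <-.
by rewrite sg_shift // iter_shift_signed_on.
Qed.

Lemma sgc_shift s : all (signed_on A) s ->
  sgc (map shift s) = sign_cochain (map (+%R^~ 1) (map sg s)).
Proof. exact: (@sgc_iter_shift s 1). Qed.

Lemma cobd_sgc s : all (signed_on A) s -> (1 < size s)%N ->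
  cobd sgc s = tau shift q.+2 (odd (size s)) sgc s.
Proof.
move=> As s1; rewrite /sgc -cobd_map cobd_sign_cochain ?size_map //.
rewrite /tau; case: ifP => _; last by rewrite -sgc_shift.
by apply: eq_bigr => i _; rewrite -sgc_iter_shift.
Qed.

(** The twisted cochain is a coboundary, so [eval_chain_cobd] lowers the degree. At the bottom,
    exactly one of the q.+2 shifts of a sign is -1. *)
Lemma eval_sgc v vs : uniq (v :: vs) -> {subset v :: vs <= A} ->
  eval_chain (v :: vs) (tau shift q.+2 (odd (size (v :: vs))) sgc) = 1.
Proof.
elim: vs v => [|v' vs IH] v.
  move=> _ vA; rewrite [LHS]/= /fill subr0 {1}/tau /=.
  have e_on : signed_on A (put v empty).
    apply: (@signed_on_sub (mem [:: v])) => //.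
    by apply: put_signed_on => x; rewrite ffunE.
  rewrite -(sum_shift_eq0 (sg (put v empty))); apply: eq_bigr => i _.
  rewrite (sgc_iter_shift (s := [:: put v empty])) /= ?e_on //.
  by rewrite iter_shift.
case/andP=> vvs uvs vsA.
rewrite -(eq_eval_chain (u := cobd sgc)) => [||s s_vs]; last 2 first.
- by rewrite cons_uniq vvs.
- have /and3P[/eqP sz _ _] := s_vs.
  by rewrite cobd_sgc ?sz //; apply: signed_chain_on s_vs.
by rewrite eval_chain_cobd IH // => x xvs; apply: vsA; rewrite in_cons xvs orbT.
Qed.

(** A nonzero value needs distinct consecutive signs, hence strictly increasing levels, and there
    are only [M] levels. *)
Lemma sgc_eq0 s : all (signed_on A) s -> path subsig empty s -> (M < size s)%N ->
  sgc s = 0.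
Proof.
move=> As ps Ms; apply/eqP; apply: contraTT Ms => /sign_cochain_sorted.
rewrite -leqNgt sorted_map => sg_srt.
have lv_srt : sorted ltn (map lv s).
  rewrite sorted_map; case: s As ps sg_srt => //= X s /andP[AX As] /andP[_].
  elim: s X AX As => //= Y s IH X AX /andP[AY As] /andP[XY ps] /andP[sXY srt].
  rewrite IH // andbT ltn_neqAle lv_le // andbT.
  by apply: contra_neq sXY; apply: sg_lv.
have := uniq_leq_size (sorted_uniq ltn_trans ltnn lv_srt) (s2 := iota 1 M).
rewrite size_map size_iota; apply => j /mapP[X /(allP As) AX ->].
by rewrite mem_iota add1n ltnS lv_bound.
Qed.

(** Otherwise the cochain vanishes on all signed chains, against the value 1 in [eval_sgc]. *)
Lemma monotone_Tucker vs : uniq vs -> {subset vs <= A} -> (size vs <= M)%N.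
Proof.
case: vs => // v vs uvs vsA; rewrite leqNgt; apply/negP => Mvs.
have := eval_sgc uvs vsA; rewrite (eq_eval_chain (w := fun=> 0 - 0)) // => [|s s_vs].
  rewrite (eval_chainB _ (fun=> 0) (fun=> 0)) subrr => /eqP.
  by rewrite eq_sym oner_eq0.
have sgc0 t : signed_chain (v :: vs) t -> sgc t = 0.
  move=> t_vs; have /and3P[/eqP sz pt _] := t_vs.
  by apply: sgc_eq0; rewrite ?sz //; apply: signed_chain_on t_vs.
have iter0 i : signed_chain (v :: vs) (map (iter i shift) s).
  elim: i => [|i IHi]; first by rewrite map_id.
  rewrite (eq_map (_ : iter i.+1 shift =1 shift \o iter i shift)) // map_comp.
  exact: shift_signed_chain.
rewrite subr0 /tau; case: ifP => _; first by rewrite big1 // => i _; apply/sgc0.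
by rewrite !sgc0 ?subrr //; apply: shift_signed_chain.
Qed.

End Equivariant.
End Tucker.

(** * Monochromatic families of rainbow sets *)

Section Families.
Variables (V B : finType) (blk : V -> B).
Implicit Types (W A : {set V}).

Definition rainbow (k : nat) W A :=
  [&& A \subset W, #|A| == k & #|blk @: A| == k].

Definition mono_family (I : finType) c k W (col : {set V} -> 'I_c)
    (F : {ffun I -> {set V}}) a :=
  [forall i, rainbow k W (F i) && (col (F i) == a)] &&
  [forall i, forall j, (i != j) ==> [disjoint F i & F j]].

Lemma mono_familyP (I : finType) c k W (col : {set V} -> 'I_c)
    (F : {ffun I -> {set V}}) a :
  reflect ((forall i : I, rainbow k W (F i) /\ col (F i) = a) /\
           (forall i j, i != j -> [disjoint F i & F j]))
    (mono_family k W col F a).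
Proof.
apply: (iffP andP) => [[/forallP T /forallP D]|[T D]]; split.
- by move=> i; case/andP: (T i) => ? /eqP.
- by move=> i j; have /forallP/(_ j)/implyP := D i; apply.
- by apply/forallP => i; case: (T i) => -> ->; rewrite eqxx.
- by apply/forallP => i; apply/forallP => j; apply/implyP/D.
Qed.

Lemma mono_family_reindex (I J : finType) (h : J -> I) c k W
    (col : {set V} -> 'I_c) (F : {ffun I -> {set V}}) a :
  injective h -> mono_family k W col F a ->
  mono_family k W col [ffun j => F (h j)] a.
Proof.
move=> inj_h /mono_familyP[T D]; apply/mono_familyP.
by split=> [j|i j ij]; rewrite !ffunE //; apply: D; rewrite (inj_eq inj_h).
Qed.

Lemma rainbow_exists k (P : {set V}) : (k <= #|blk @: P|)%N ->
  exists A, rainbow k P A.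
Proof.
elim: k => [|k IH] kP; first by exists set0; rewrite /rainbow sub0set imset0 !cards0.
have [A /and3P[AP /eqP Ak /eqP bk]] := IH (ltnW kP).
have [b bP bA] : exists2 b, b \in blk @: P & b \notin blk @: A.
  by apply/subsetPn; apply: contraTN kP => /subset_leq_card; rewrite bk -leqNgt.
have /imsetP[v vP vb] := bP; rewrite {}vb in bA.
exists (v |: A); rewrite /rainbow subUset sub1set vP AP /= imsetU1 !cardsU1.
by rewrite bA (contra (@imset_f _ _ blk _ v) bA) Ak bk !add1n !eqxx.
Qed.

End Families.

(** * The bound for a prime p *)

Section PrimeCase.
Variables (p : nat) (p_pr : prime p).
Local Notation G := 'F_p.

Definition shift_set (I : {set G}) : {set G} := [set x | x - 1 \in I].
Definition mixed (I : {set G}) := (I != set0) && (I != setT).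
Definition center (I : {set G}) : G := (\sum_(i in I) i) / #|I|%:R.

Lemma sum_shift_set (I : {set G}) (R : nmodType) (f : G -> R) :
  \sum_(i in shift_set I) f i = \sum_(i in I) f (i + 1).
Proof.
rewrite (reindex_inj (addIr 1)) /=; apply: eq_bigl => i.
by rewrite inE addrK.
Qed.

Lemma card_shift_set I : #|shift_set I| = #|I|.
Proof.
rewrite -(card_imset I (addIr 1)); apply: eq_card => x; rewrite inE.
apply/idP/imsetP => [xI|[y yI ->]]; last by rewrite addrK.
by exists (x - 1); rewrite ?subrK.
Qed.

Lemma mixed_shift_set I : mixed (shift_set I) = mixed I.
Proof.
by rewrite /mixed -!cards_eq0 !eqEcard !subsetT card_shift_set.
Qed.

(** The shift adds |I| to the sum, and 0 < |I| < p makes |I| invertible modulo the prime p. *)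
Lemma center_shift_set I : mixed I -> center (shift_set I) = center I + 1.
Proof.
case/andP=> I0 IT; rewrite /center sum_shift_set card_shift_set big_split /=.
rewrite sumr_const mulrDl divff //.
rewrite -(dvdn_pcharf (pchar_Fp p_pr)); apply: contraNN IT => /dvdn_leq.
rewrite card_gt0 => /(_ I0); rewrite eqEcard subsetT cardsT card_Fp //.
Qed.

Definition fsign (T : finType) (J : T -> {set G}) : option G :=
  omap (fun t => center (J t)) [pick t | mixed (J t)].

Lemma eq_fsign (T : finType) (J J' : T -> {set G}) : J =1 J' -> fsign J = fsign J'.
Proof.
move=> E; rewrite /fsign (eq_pick (Q := fun t => mixed (J' t))) => [|t].
  by case: pickP => //= t _; rewrite E.
by rewrite E.
Qed.

(** The picked t depends only on which sets are mixed, and shifts preserve this. *)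
Lemma fsign_shift (T : finType) (J : T -> {set G}) :
  fsign (fun t => shift_set (J t)) = omap (+%R^~ 1) (fsign J).
Proof.
rewrite /fsign (eq_pick (Q := fun t => mixed (J t))) => [|t].
  by case: pickP => //= t mt; rewrite center_shift_set.
by rewrite /= mixed_shift_set.
Qed.

Lemma fsign_None (T : finType) (J : T -> {set G}) t :
  fsign J = None -> J t != set0 -> J t = setT.
Proof.
rewrite /fsign; case: pickP => // /(_ t); rewrite /mixed => /negbT.
by rewrite negb_and => /orP[/negP|/negPn/eqP].
Qed.

Lemma sum_card_eq (T : finType) (J J' : T -> {set G}) :
  (forall t, J t \subset J' t) -> (\sum_t #|J t|)%N = (\sum_t #|J' t|)%N ->
  J =1 J'.
Proof.
move=> sub /eqP.
have := leqif_sum (fun t (_ : xpredT t) => subset_leqif_cards (sub t)).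
by move=> [_ ->] /forallP E t; apply/eqP/E.
Qed.

Variables (V B : finType) (blk : V -> B) (W : {set V}) (k c : nat).
Variable col : {set V} -> 'I_c.
Local Notation svec := {ffun V -> option G}.
Implicit Types (X Y : svec).

Hypothesis k_gt0 : (0 < k)%N.
Hypothesis fibers : forall b, (#|[set v in W | blk v == b]| <= p)%N.
Hypothesis no_family :
  forall (F : {ffun G -> {set V}}) a, ~~ mono_family blk k W col F a.

Definition part X i : {set V} := [set v | X v == Some i].
Definition block_signs X b : {set G} :=
  [set i | [exists v in part X i, blk v == b]].
Definition color_signs X a : {set G} :=
  [set i | [exists A : {set V},
    [&& A \subset part X i, rainbow blk k W A & col A == a]]].
Definition good X := [exists a, color_signs X a != set0].
Definition level X : nat :=
  if good X then (p * k.-1 + \sum_a #|color_signs X a|)%N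
  else (\sum_b #|block_signs X b|)%N.
Definition first_sign X : G := odflt 0 (obind X [pick v | X v != None]).
Definition vec_sign X : G :=
  if good X then odflt 0 (fsign (color_signs X))
  else odflt (first_sign X) (fsign (block_signs X)).

Lemma part_shift X i : part (shift X) i = part X (i - 1).
Proof.
apply/setP => v; rewrite !inE ffunE; case: (X v) => //= a.
by rewrite !(inj_eq Some_inj) eq_sym -subr_eq eq_sym.
Qed.

Lemma block_signs_shift X b : block_signs (shift X) b = shift_set (block_signs X b).
Proof. by apply/setP => i; rewrite !inE part_shift. Qed.

Lemma color_signs_shift X a : color_signs (shift X) a = shift_set (color_signs X a).
Proof. by apply/setP => i; rewrite !inE part_shift. Qed.

Lemma good_shift X : good (shift X) = good X.
Proof.
apply: eq_existsb => a; rewrite color_signs_shift -!cards_eq0.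
by rewrite card_shift_set.
Qed.

Lemma part_sub X Y i : subsig X Y -> part X i \subset part Y i.
Proof.
move=> /subsigP XY; apply/subsetP => v; rewrite !inE => /eqP /XY ->.
exact: eqxx.
Qed.

Lemma block_signs_sub X Y b : subsig X Y -> block_signs X b \subset block_signs Y b.
Proof.
move=> XY; apply/subsetP => i; rewrite !inE => /exists_inP[v vi vb].
by apply/exists_inP; exists v => //; apply: subsetP vi; apply: part_sub.
Qed.

Lemma color_signs_sub X Y a : subsig X Y -> color_signs X a \subset color_signs Y a.
Proof.
move=> XY; apply/subsetP => i; rewrite !inE => /existsP[A /and3P[Ai At Aa]].
by apply/existsP; exists A; rewrite At Aa (subset_trans Ai) // part_sub.
Qed.

Lemma good_sub X Y : subsig X Y -> good X -> good Y.
Proof.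
move=> XY /existsP[a /set0Pn[i iX]]; apply/existsP; exists a.
by apply/set0Pn; exists i; apply: subsetP iX; apply: color_signs_sub.
Qed.

(** One rainbow set of color [a] for each sign would give the excluded family, since distinct parts
    of [X] are disjoint. *)
Lemma color_signs_neqT X a : color_signs X a != setT.
Proof.
apply/negP => /eqP cT.
have ex i : exists A : {set V},
    [&& A \subset part X i, rainbow blk k W A & col A == a].
  by apply/existsP; have := in_setT i; rewrite -cT inE.
case/negP: (no_family [ffun i => xchoose (ex i)] a); apply/mono_familyP.
split=> [i|i j ij]; rewrite !ffunE.
  by have /and3P[_ -> /eqP] := xchooseP (ex i).
have /and3P[si _ _] := xchooseP (ex i); have /and3P[sj _ _] := xchooseP (ex j).
apply: disjointWl si _; apply: disjointWr sj _.
rewrite -setI_eq0; apply/eqP/setP => v; rewrite !inE.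
apply: contraNF ij => /andP[/eqP -> /eqP[->]]; exact: eqxx.
Qed.

(** Count the pairs of a sign and a block by signs: a part meeting k blocks would contain a rainbow
    k-set. *)
Lemma bad_level X : signed_on (mem W) X -> ~~ good X ->
  (\sum_b #|block_signs X b| <= p * k.-1)%N.
Proof.
case/signed_onP=> _ XW bad.
have -> : (\sum_b #|block_signs X b| = \sum_(i : G) #|blk @: part X i|)%N.
  under eq_bigr do rewrite -sum1_card.
  under [RHS]eq_bigr do rewrite -sum1_card.
  rewrite (exchange_big_dep xpredT) //=; apply: eq_bigr => i _.
  apply: eq_bigl => b; rewrite inE; apply/exists_inP/imsetP.
    by case=> v vi /eqP <-; exists v.
  by case=> v vi ->; exists v.
rewrite -[X in (X * _)%N](card_Fp p_pr) -sum_nat_const; apply: leq_sum => i _.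
rewrite -ltnS prednK // ltnNge; apply: contra bad.
case/rainbow_exists => A /and3P[AP Ak bk]; apply/existsP; exists (col A).
apply/set0Pn; exists i; rewrite inE; apply/existsP; exists A.
rewrite AP eqxx /rainbow Ak bk /= !andbT (subset_trans AP) //.
by apply/subsetP => v; rewrite inE => /eqP Xv; apply: XW; rewrite Xv.
Qed.

Lemma good_level X : (\sum_a #|color_signs X a| <= p.-1 * c)%N.
Proof.
rewrite mulnC -[X in (X * _)%N]card_ord -sum_nat_const; apply: leq_sum => a _.
have : color_signs X a \proper setT by rewrite properEneq color_signs_neqT subsetT.
by move=> /proper_card; rewrite cardsT card_Fp //; have := prime_gt0 p_pr; lia.
Qed.

Lemma card_sum_gt0 (T : finType) (J : T -> {set G}) t :
  J t != set0 -> (0 < \sum_t #|J t|)%N.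
Proof. by rewrite -card_gt0 => ?; rewrite (bigD1 t) //= ltn_addr. Qed.

Lemma level_bound X : signed_on (mem W) X ->
  (0 < level X <= p.-1 * c + p * k.-1)%N.
Proof.
move=> XW; rewrite /level; case: ifPn => [gX|bX].
  rewrite addnC leq_add2r good_level andbT ltn_addr //.
  by have /existsP[a /card_sum_gt0] := gX.
rewrite (leq_trans (bad_level XW bX)) ?leq_addl // andbT.
have /signed_onP[[v]] := XW; case Xv: (X v) => [i|] // _ _.
apply: (@card_sum_gt0 _ _ (blk v)); apply/set0Pn; exists i.
by rewrite inE; apply/exists_inP; exists v; rewrite // inE Xv.
Qed.

Lemma level_le X Y : signed_on (mem W) X -> signed_on (mem W) Y ->
  subsig X Y -> (level X <= level Y)%N.
Proof.
move=> XW YW XY; rewrite /level; case: ifPn => [gX|bX].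
  rewrite (good_sub XY gX) leq_add2l; apply: leq_sum => a _.
  exact/subset_leq_card/color_signs_sub.
case: ifP => [_|_]; first by rewrite (leq_trans (bad_level XW bX)) ?leq_addr.
by apply: leq_sum => b _; apply/subset_leq_card/block_signs_sub.
Qed.

(** A block met by [Y] carries all p signs in [X]. It has at most p elements in [W], so [X] is
    already nonzero on all of them. *)
Lemma full_blocks_eq X Y : signed_on (mem W) Y -> subsig X Y ->
  block_signs X =1 block_signs Y -> fsign (block_signs X) = None -> X = Y.
Proof.
move=> /signed_onP[_ YW] XY bXY fX; apply/ffunP => v.
case Yv: (Y v) => [y|]; last first.
  by case Xv: (X v) => [x|] //; have /subsigP/(_ _ _ Xv) := XY; rewrite Yv.
suff: X v != None.
  by case Xv: (X v) => [x|] // _; have /subsigP/(_ _ _ Xv) := XY; rewrite Yv.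
have fullb : block_signs X (blk v) = setT.
  apply: (fsign_None fX); apply/set0Pn; exists y; rewrite bXY inE.
  by apply/exists_inP; exists v; rewrite // inE Yv.
pose S := [set x in W | (blk x == blk v) && (X x != None)].
have fiberE : S = [set x in W | blk x == blk v].
  apply/eqP; rewrite eqEcard; apply/andP; split.
    by apply/subsetP => x; rewrite !inE => /and3P[-> ->].
  apply: leq_trans (fibers _) _.
  have <- : #|Some @: [set: G]| = p.
    by rewrite (card_imset _ Some_inj) cardsT card_Fp.
  apply: leq_trans (leq_imset_card X S).
  apply/subset_leq_card/subsetP => _ /imsetP[i _ ->]; apply/imsetP.
  have : i \in block_signs X (blk v) by rewrite fullb inE.
  rewrite inE => /exists_inP[x]; rewrite inE => /eqP Xx xv; exists x => //.
  rewrite inE xv Xx !andbT; apply: YW.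
  by have /subsigP/(_ _ _ Xx) -> := XY.
have : v \in S by rewrite fiberE !inE eqxx andbT; apply: YW; rewrite Yv.
by rewrite inE => /and3P[].
Qed.

Lemma sign_level X Y : signed_on (mem W) X -> signed_on (mem W) Y ->
  subsig X Y -> level X = level Y -> vec_sign X = vec_sign Y.
Proof.
move=> XW YW XY; rewrite /level /vec_sign.
case: ifPn => [gX|bX]; first rewrite (good_sub XY gX) => /addnI E.
  by rewrite (eq_fsign (sum_card_eq _ E)) // => a; apply: color_signs_sub.
(* A good [Y] has level above p(k-1), so it cannot share the level of a bad [X]. *)
case: ifPn => [/existsP[a /card_sum_gt0 gY]|bY] E.
  by have := bad_level XW bX; rewrite E -[leqRHS]addn0 leq_add2l leqNgt gY.
have bXY : block_signs X =1 block_signs Y.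
  by apply: sum_card_eq E => b; apply: block_signs_sub.
rewrite -(eq_fsign bXY); case fX: (fsign _) => [x|] //=.
by rewrite (full_blocks_eq YW XY bXY fX).
Qed.

Lemma vec_sign_shift X : signed_on (mem W) X -> vec_sign (shift X) = vec_sign X + 1.
Proof.
move=> XW; rewrite /vec_sign good_shift; case: ifP => [/existsP[a aX]|_].
  rewrite (eq_fsign (color_signs_shift X)) fsign_shift.
  (* The default 0 is never reached: a nonempty set of color signs is not full, hence mixed. *)
  case fX: (fsign _) => [x|] //=.
  by have := color_signs_neqT X a; rewrite (fsign_None fX aX) eqxx.
rewrite (eq_fsign (block_signs_shift X)) fsign_shift.
case: (fsign _) => [x|] //=; rewrite /first_sign.
rewrite (eq_pick (Q := fun v => X v != None)) => [|v]; last by rewrite /= shift_eqN.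
case: pickP => [v|none] /=; first by rewrite ffunE; case: (X v).
by have /signed_onP[[v]] := XW; rewrite none.
Qed.

Lemma card_le_prime : (#|W| <= p.-1 * c + p * k.-1)%N.
Proof.
rewrite cardE; apply: (monotone_Tucker (A := mem W) vec_sign_shift level_bound
  level_le sign_level); first exact: enum_uniq.
by move=> v; rewrite mem_enum.
Qed.

End PrimeCase.

(** * From primes to all positive r *)

Lemma card_div_fiber (T : finType) (A : {set T}) (f : T -> nat) r j :
  (0 < r)%N -> {in A &, injective f} -> {in A, forall v, f v %/ r = j}%N ->
  (#|A| <= r)%N.
Proof.
case: r => // r _ f_inj f_j; rewrite -[leqRHS]card_ord.
pose g v : 'I_r.+1 := inord (f v %% r.+1).
rewrite -(card_in_imset (f := g)) ?max_card // => v w vA wA /(congr1 val) /=.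
rewrite !inordK ?ltn_mod // => E; apply: f_inj => //.
by rewrite (divn_eq (f v) r.+1) (divn_eq (f w) r.+1) !f_j // E.
Qed.

Definition kneser_bound r := forall (V B : finType) (blk : V -> B) (W : {set V})
    (k c : nat) (col : {set V} -> 'I_c),
  (0 < k)%N -> (forall b, #|[set v in W | blk v == b]| <= r)%N ->
  (r.-1 * c + r * k.-1 < #|W|)%N ->
  exists (F : {ffun 'I_r -> {set V}}) a, mono_family blk k W col F a.

Lemma kneser_bound_prime p : prime p -> kneser_bound p.
Proof.
move=> p_pr V B blk W k c col k_gt0 fibers Wbig.
have /existsP[F /existsP[a Fa]] : [exists F : {ffun 'F_p -> {set V}}, exists a,
    mono_family blk k W col F a].
  apply: contraTT Wbig; rewrite negb_exists => /forallP none; rewrite -leqNgt.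
  apply: (card_le_prime p_pr k_gt0 fibers (col := col)) => F a.
  by have := none F; rewrite negb_exists => /forallP.
exists [ffun i => F (cast_ord (esym (Fp_cast p_pr)) i)], a.
exact: (mono_family_reindex (@cast_ord_inj _ _ _)).
Qed.

Lemma kneser_bound1 : kneser_bound 1.
Proof.
move=> V B blk W k c col k_gt0 fibers; rewrite mul0n mul1n prednK // => kW.
have inj : {in W &, injective blk}.
  move=> v w vW wW E; have /card_le1_eqP := fibers (blk v).
  by apply; rewrite !inE ?vW ?wW ?E /=.
have [|A Ak] := @rainbow_exists _ _ blk k W; first by rewrite card_in_imset.
exists [ffun=> A], (col A); apply/mono_familyP; split=> [i|i j].
  by rewrite ffunE.
by rewrite [i]ord1 [j]ord1 eqxx.
Qed.

Lemma kneser_boundM r1 r2 : (0 < r1)%N -> (0 < r2)%N ->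
  kneser_bound r1 -> kneser_bound r2 -> kneser_bound (r1 * r2).
Proof.
move=> r1_gt0 r2_gt0 bound1 bound2 V B blk W k c col k_gt0 fibers Wbig.
pose fiber b := [set v in W | blk v == b].
(* Numbering each block and dividing by [r2] cuts it into at most [r1] subblocks of size at most
   [r2]. *)
pose rank v := index v (enum (fiber (blk v))).
have rank_lt v : v \in W -> (rank v %/ r2 < r1)%N.
  move=> vW; rewrite ltn_divLR //; apply: leq_trans (fibers (blk v)).
  by rewrite cardE index_mem mem_enum inE vW /=.
pose blk' v : B * 'I_r1.-1.+1 := (blk v, inord (rank v %/ r2)).
have fibers' b : (#|[set v in W | blk' v == b]| <= r2)%N.
  case: b => b j.
  apply: (card_div_fiber (f := rank) (j := j)) => // [v w|v]; rewrite !inE.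
    case/andP=> vW /eqP[vb _] /andP[wW /eqP[wb _]].
    rewrite /rank vb wb => E; rewrite -[v](@nth_index _ v _ (enum (fiber b))).
      by rewrite E nth_index // mem_enum inE wW wb /=.
    by rewrite mem_enum inE vW vb /=.
  by case/andP=> vW /eqP[_ <-]; rewrite inordK // prednK // rank_lt.
pose n1 := (r1.-1 * c + r1 * k.-1).+1.
pose P S a := [exists F : {ffun 'I_r1 -> {set V}}, mono_family blk k S col F a].
(* On the sets [F j] below, the bound for [r1] supplies a family, so the default is not reached. *)
pose col' S := odflt (col set0) [pick a | P S a].
(* With [n1] as the size, the bounds add up exactly: (r2-1)c + r2((r1-1)c + r1(k-1)) = (r1 r2-1)c +
   r1 r2(k-1). *)
have [|F [a /mono_familyP[FT FD]]] := bound2 _ _ blk' W n1 c col' isT fibers'.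
  apply: leq_ltn_trans Wbig; rewrite /n1 /=.
  case: r1 r2 r1_gt0 r2_gt0 {bound1 bound2 fibers rank_lt blk' fibers' n1 P col'}
    => [|x] [|y] //= _ _; nia.
have PF j : P (F j) a.
  have [/and3P[FW /eqP Fn /eqP bFn] colF] := FT j.
  have [||Fj [a' Fa']] := bound1 _ _ blk (F j) k c col k_gt0; last 1 first.
  - move: colF; rewrite /col'; case: pickP => [a'' Pa'' /= <- //|none].
    by have /negP[] := negbT (none a'); apply/existsP; exists Fj.
  (* [F j] has at most one element in each of the at most [r1] subblocks of a block. *)
  - move=> b.
    have inj : {in F j &, injective blk'} by apply/imset_injP; rewrite bFn Fn.
    rewrite -(card_in_imset (f := fun v => (blk' v).2)); last first.
      move=> v w; rewrite !inE => /andP[vF /eqP vb] /andP[wF /eqP wb] E.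
      by apply: inj => //; rewrite /blk' vb wb; congr pair; apply: E.
    by apply: leq_trans (max_card _) _; rewrite card_ord prednK.
  by rewrite Fn /n1.
have {PF} [G PG] : exists G : 'I_r2 -> {ffun 'I_r1 -> {set V}},
    forall j, mono_family blk k (F j) col (G j) a.
  exists (fun j => xchoose (existsP (PF j))) => j.
  by apply: (xchooseP (existsP (PF j))).
pose FF := [ffun x : 'I_r1 * 'I_r2 => G x.2 x.1].
have cardI : (r1 * r2 = #|{: 'I_r1 * 'I_r2}|)%N by rewrite card_prod !card_ord.
exists [ffun i => FF (enum_val (cast_ord cardI i))], a.
apply: (mono_family_reindex (F := FF) (h := fun i => enum_val (cast_ord cardI i))).
  by move=> i j /enum_val_inj /cast_ord_inj.
apply/mono_familyP; split=> [[i j]|[i j] [i' j'] ij]; rewrite /FF !ffunE /=.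
  have /mono_familyP[/(_ i)[/and3P[GF Gk bGk] Ga] _] := PG j.
  have [/and3P[FW _ _] _] := FT j.
  by rewrite /rainbow (subset_trans GF FW) Gk bGk.
have /mono_familyP[/(_ i)[/and3P[GF _ _] _] GD] := PG j.
have /mono_familyP[/(_ i')[/and3P[GF' _ _] _] _] := PG j'.
have [jj|jj] := eqVneq j j'; last first.
  by apply: disjointWl GF _; apply: disjointWr GF' _; apply: FD.
rewrite -jj; apply: GD; by apply: contraNneq ij => ->; rewrite jj.
Qed.

Lemma kneser_bound_gt0 r : (0 < r)%N -> kneser_bound r.
Proof.
have [m] := ubnP r; elim: m r => // m IH r rm r_gt0.
have [r1|r1] := leqP r 1%N.
  by have -> : r = 1%N; [lia | exact: kneser_bound1].
have p_pr := pdiv_prime r1; have dv := pdiv_dvd r.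
rewrite -(divnK dv); apply: kneser_boundM.
- by rewrite divn_gt0 ?pdiv_gt0 // dvdn_leq.
- exact: pdiv_gt0.
- apply: IH; last by rewrite divn_gt0 ?pdiv_gt0 // dvdn_leq.
  have := ltn_Pdiv (prime_gt1 p_pr) r_gt0. lia.
exact: kneser_bound_prime.
Qed.

Arguments kneser_bound_gt0 [r] _ [V B blk W k c].

(** * Wide sets *)

Section Wide.
Variables (r n k : nat) (t : int).
Hypotheses (r_gt1 : (1 < r)%N) (k_gt0 : (0 < k)%N).
Hypothesis t_le : t <= r%:Z * (k%:Z - 2) + 1.

Let r_gt0 : (0 < r)%N := ltnW r_gt1.

Definition interval_block (v : 'I_n) : 'I_n.+1 := inord (v %/ r).

Lemma interval_blockE v : interval_block v = (v %/ r)%N :> nat.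
Proof. by rewrite inordK // ltnS (leq_trans (leq_div _ _)) // ltnW. Qed.

(** For k >= 2, the integers from i to i + r(k-2) meet at most k-1 consecutive blocks, listed by
    [f], while a rainbow k-set meets k. For k = 1 the window is empty, as t <= 1 - r. *)
Lemma rainbow_wide W (A : {set 'I_n}) (Ak : #|A| == k) :
  rainbow interval_block k W A -> (Sub A Ak : ksubset n k) \in wide n k t.
Proof.
case/and3P=> _ _ /eqP bk; rewrite inE; apply/forallP => i.
apply/negP; rewrite SubK => /subsetP Awin.
have A_le v : v \in A -> (i <= v)%N /\ v%:Z < i%:Z + (r%:Z * (k%:Z - 2) + 1).
  move=> /Awin; rewrite inE => /andP[iv vi]; split; first by rewrite -lez_nat.
  by apply: lt_le_trans vi _; rewrite lerD2l.
have [k1|k1] := leqP k 1%N.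
  have /card_gt0P[v vA] : (0 < #|A|)%N by rewrite (eqP Ak).
  have [iv] := A_le v vA; have -> : k = 1%N by lia.
  by move=> vi; nia.
have : (#|interval_block @: A| <= k.-1)%N; last by rewrite bk; lia.
rewrite -[leqRHS]card_ord -cardsT.
pose f (j : 'I_k.-1) : 'I_n.+1 := inord (i %/ r + j).
apply: leq_trans (leq_imset_card f _); apply/subset_leq_card/subsetP => b.
case/imsetP=> v vA ->; have [iv vi] := A_le v vA.
have v_le : (v <= (k - 2) * r + i)%N by move: vi; nia.
have lo : (i %/ r <= v %/ r)%N by apply: leq_div2r.
have hi : (v %/ r <= k - 2 + i %/ r)%N.
  by rewrite -divnMDl //; apply: leq_div2r.
have jk : (v %/ r - i %/ r < k.-1)%N by lia.
apply/imsetP; exists (Ordinal jk) => //; apply/val_inj.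
rewrite /= interval_blockE inordK /= subnKC //.
by rewrite ltnS (leq_trans (leq_div _ _)) // ltnW.
Qed.

Lemma interval_block_fibers b :
  (#|[set v in [set: 'I_n] | interval_block v == b]| <= r)%N.
Proof.
apply: (card_div_fiber (f := @nat_of_ord n) (j := b)) => //.
  by move=> v w _ _; apply: val_inj.
by move=> v; rewrite !inE /= => /eqP <-; rewrite interval_blockE.
Qed.

Lemma colorable_kneser_wide_lower c : (r * k <= n)%N ->
  colorable (kneser_wide r n k t) c -> (n <= r.-1 * c + r * k.-1)%N.
Proof.
move=> rk_n /existsP[f /forall_inP f_proper]; rewrite leqNgt; apply/negP => n_big.
(* A default color is needed to extend [f] to all sets. A wide vertex exists by the bound for one
   color, since (r-1) + r(k-1) = rk - 1 < n. *)
have c_gt0 : (0 < c)%N.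
  have [|F [a /mono_familyP[FT _]]] := 
    kneser_bound_gt0 r_gt0 (fun=> ord0 : 'I_1) k_gt0 interval_block_fibers.
    by rewrite cardsT card_ord; nia.
  have [Frb _] := FT (Ordinal r_gt0); have /and3P[_ Fk _] := Frb.
  pose K : {A : ksubset n k | A \in wide n k t} :=
    exist (fun A => A \in wide n k t) _ (rainbow_wide Fk Frb).
  exact: leq_ltn_trans (leq0n _) (ltn_ord (f K)).
pose col A : 'I_c := odflt (Ordinal c_gt0)
  (obind (fun K => omap f (insub K)) (insub A : option (ksubset n k))).
have [|F [a /mono_familyP[FT FD]]] := kneser_bound_gt0 r_gt0 col k_gt0
    interval_block_fibers.
  by rewrite cardsT card_ord.
have Fk i : #|F i| == k by have [/and3P[]] := FT i.
have Fw i : (Sub (F i) (Fk i) : ksubset n k) \in wide n k t.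
  by have [Frb _] := FT i; apply: rainbow_wide Frb.
pose v i : {A : ksubset n k | A \in wide n k t} :=
  exist (fun A => A \in wide n k t) _ (Fw i).
have v_inj : injective v.
  move=> i j /(congr1 (fun x => val (val x))) /= Fij; apply/eqP.
  apply: contraT => /FD; rewrite -setI_eq0 -Fij setIid => /eqP F0.
  by have := Fk i; rewrite F0 cards0 eq_sym -leqn0 leqNgt k_gt0.
have /f_proper/negP[] : v @: setT \in kneser_wide r n k t.
  rewrite !inE (card_imset _ val_inj) (card_imset _ v_inj) cardsT card_ord eqxx /=.
  apply/forall_inP => _ /imsetP[_ /imsetP[i _ ->] ->].
  apply/forall_inP => _ /imsetP[_ /imsetP[j _ ->] ->].
  by apply/implyP => ij; rewrite /= FD //; apply: contraNneq ij => ->.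
apply/existsP; exists a; apply/forall_inP => _ /imsetP[i _ ->].
have [_ <-] := FT i.
have E1 : insub (F i) = Some (Sub (F i) (Fk i) : ksubset n k)  :=
  insubT (fun A : {set 'I_n} => #|A| == k) (Fk i).
have E2 : insub (Sub (F i) (Fk i) : ksubset n k) = Some (v i)  :=
  insubT (fun A : ksubset n k => A \in wide n k t) (Fw i).
by rewrite /col E1 /= E2.
Qed.

End Wide.

(** * The upper bound: an explicit coloring *)

Lemma disjoint_card_bound (I T : finType) (e : {set I}) (S : I -> {set T})
    (Z : {set T}) m :
  {in e &, forall i j, i != j -> [disjoint S i & S j]} ->
  {in e, forall i, m <= #|S i :&: Z|}%N -> (#|e| * m <= #|Z|)%N.
Proof.
move=> dS mS; rewrite -sum_nat_const.
apply: (@leq_trans (\sum_(i in e) #|S i :&: Z|)%N); first exact: leq_sum.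
under eq_bigr do rewrite -sum1_card.
rewrite (exchange_big_dep (mem Z)) => [|i x _ /setIP[] //].
rewrite -[leqRHS]sum1_card; apply: leq_sum => x xZ.
rewrite sum1_card; apply/card_le1_eqP => i j.
move=> /andP[ie /setIP[xi _]] /andP[je /setIP[xj _]].
apply/eqP; apply: contraT => ij.
have := dS j i je ie ij.
by rewrite -setI_eq0 => /eqP/setP/(_ x); rewrite !inE xi xj.
Qed.

Lemma colorable_kneser_wide_upper r n k t c : (1 < r)%N -> (0 < k)%N ->
  (0 < c)%N -> (n <= r.-1 * c + r * k.-1)%N ->
  colorable (kneser_wide r n k t) c.
Proof.
(* From here on [c] counts the intervals, one less than the number of colors. *)
case: c => // c r_gt1 k_gt0 _ n_le.
pose meets (A : {set 'I_n}) (j : 'I_c) := [exists v in A, v %/ r.-1 == j]%N.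
pose vertex := {A : ksubset n k | A \in wide n k t}.
pose base (K : vertex) : {set 'I_n} := val (val K).
pose f : {ffun vertex -> 'I_c.+1} := [ffun K =>
  if [pick j | meets (base K) j] is Some j then inord j else ord_max].
apply/existsP; exists f; apply/forall_inP => e eH.
have e_r := card_kneser_wide eH.
have dis : {in e &, forall K L : vertex, K != L -> [disjoint base K & base L]}.
  move=> K L Ke Le KL; move: eH; rewrite !inE => /andP[_ /forall_inP/(_ (val K))].
  rewrite imset_f // => /(_ isT) /forall_inP/(_ (val L)); rewrite imset_f //.
  by move=> /(_ isT) /implyP; apply; rewrite (inj_eq val_inj).
apply/negP => /existsP[a /forall_inP fa].
have fP K : K \in e -> if (insub (a : nat) : option 'I_c) is Some j
    then is_true (meets (base K) j) else forall j, ~~ meets (base K) j.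
  move=> /fa; rewrite ffunE; case: pickP => [j mj /eqP <-|none /eqP <-].
    by rewrite inordK ?ltnS ?(ltnW (ltn_ord j)) // valK.
  by rewrite insubF ?ltnn // => j; rewrite none.
case aj: (insub (a : nat) : option 'I_c) fP => [j|] fP.
  pose Z := [set v : 'I_n | v %/ r.-1 == j]%N.
  have Z_le : (#|Z| <= r.-1)%N.
    apply: (card_div_fiber (f := @nat_of_ord n) (j := j)); first by lia.
      by move=> v w _ _; apply: val_inj.
    by move=> v; rewrite inE => /eqP.
  (* At most r-1 disjoint sets can meet an interval of r-1 elements. *)
  have := disjoint_card_bound (m := 1) (Z := Z) dis; rewrite e_r muln1 => r_le.
  suff /r_le : {in e, forall K : vertex, 0 < #|base K :&: Z|}%N by lia.
  move=> K /fP /exists_inP[v vK vj]; apply/card_gt0P; exists v.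
  by rewrite !inE vK.
pose Z := [set v : 'I_n | r.-1 * c <= v]%N.
have Z_le : (#|Z| <= n - r.-1 * c)%N.
  have : uniq (map val (enum Z)).
    by rewrite map_inj_uniq ?enum_uniq //; apply: val_inj.
  move/uniq_leq_size => /(_ (iota (r.-1 * c) (n - r.-1 * c))).
  rewrite size_map size_iota -cardE; apply => _ /mapP[v vZ ->].
  move: vZ; rewrite mem_enum inE mem_iota => mv; rewrite mv /=.
  by have := ltn_ord v; lia.
(* Here |Z| <= n - (r-1)c <= rk - 1, too small for r disjoint k-sets. *)
have := disjoint_card_bound (m := k) (Z := Z) dis; rewrite e_r => r_le.
have rk : (r * k = r + r * k.-1)%N by rewrite -mulnS prednK.
suff /r_le : {in e, forall K : vertex, k <= #|base K :&: Z|}%N by rewrite rk; lia.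
move=> K Ke; have Kn := fP K Ke.
suff /setIidPl -> : base K \subset Z by rewrite (eqP (valP (val K))).
apply/subsetP => v vK; rewrite inE leqNgt; apply/negP => v_lt.
have vc : (v %/ r.-1 < c)%N by rewrite ltn_divLR 1?mulnC //; lia.
have /exists_inP[] := Kn (Ordinal vc); by exists v.
Qed.

(** * The chromatic number as a ceiling *)

Theorem theorem9 (k r n : nat) (t : int)
  (hk : (1 <= k)%N) (hr : (2 <= r)%N) (hn : (r * k <= n)%N)
  (ht : t <= r%:Z * (k%:Z - 2) + 1) :
  (chromatic_number (kneser_wide r n k t))%:Z =
  Num.ceil ((n%:Q - r%:Q * (k%:Q - 1)) / (r%:Q - 1)).
Proof.
set chi := chromatic_number _.
have [|chi_col chi_min] := @chromatic_numberP _ (kneser_wide r n k t).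
  by move=> e /card_kneser_wide ->.
have lower := colorable_kneser_wide_lower hr hk ht hn chi_col.
rewrite -/chi in lower chi_min.
have upper c : (0 < c)%N -> (n <= r.-1 * c + r * k.-1)%N -> (chi <= c)%N.
  by move=> c0 nc; apply/chi_min/colorable_kneser_wide_upper.
have lowerZ : n%:Z - r%:Z * (k%:Z - 1) <= chi%:Z * (r%:Z - 1).
  by move: lower; nia.
have upperZ : (chi%:Z - 1) * (r%:Z - 1) < n%:Z - r%:Z * (k%:Z - 1).
  (* If chi <= 1, the left side is at most 0 and the right side at least r, as n >= rk. Otherwise a
     failure would let chi - 1 colors suffice. *)
  have [chi1|chi1] := leqP chi 1; first by nia.
  suff : (r.-1 * chi.-1 + r * k.-1 < n)%N by nia.
  by rewrite ltnNge; apply/negP => /upper; lia.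
have r1 : 0 < r%:Q - 1 by rewrite subr_gt0 ltr1n.
apply/le_anti/andP; split.
  (* For the integer chi, being at most the ceiling of x means chi - 1 < x. *)
  rewrite -ltzD1 -ltrBlDr ceil_gt_int ltr_pdivlMr //.
  move: upperZ; rewrite -(ltr_int rat).
  by rewrite !rmorphM !rmorphB !rmorphM !rmorphB /=.
rewrite ceil_le_int ler_pdivrMr //.
move: lowerZ; rewrite -(ler_int rat).
by rewrite !rmorphM !rmorphB !rmorphM !rmorphB /=.
Qed.
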